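(* Let $X=\theta+Z$, $\theta\in\mathbb{R}$, be a location model in which the real random variable $Z$ is strictly skewed. Let $\mathscr{D}_{\mathrm{eq}}:=\{\delta_b:\ \delta_b(x)=x-b,\ b\in\mathbb{R}\}$ be the location-equivariant decision class, and let $\mathcal{O}$ be oracle risk minimization over $\mathscr{D}_{\mathrm{eq}}$: for a loss $L(\theta,a)=\ell(a-\theta)$, the risk $\mathbb{E}_\theta[L(\theta,\delta_b(X))]=\mathbb{E}[\ell(Z-b)]$ does not depend on $\theta$, and $\delta_b\in\mathcal{O}(L)$ iff $b$ minimizes this risk over $\mathbb{R}$ (equivalently, iff $\mathbb{E}[\ell'(Z-b)]=0$). Then the canonical Huber losses $\{L_\kappa:\kappa>0\}$ are pairwise exclusively realizable over $\mathscr{D}_{\mathrm{eq}}$: for all $\kappa,\kappa'>0$ with $\kappa\neq\kappa'$, no $\delta\in\mathscr{D}_{\mathrm{eq}}$ belongs to both $\mathcal{O}(L_\kappa)$ and $\mathcal{O}(L_{\kappa'})$.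
   Context: For $\kappa>0$ the canonical Huber loss is $L_\kappa(\theta,a)=\frac12(a-\theta)^2$ if $|a-\theta|\le\kappa$ and $L_\kappa(\theta,a)=\kappa|a-\theta|-\frac12\kappa^2$ if $|a-\theta|>\kappa$. Its derivative in the residual $u=a-\theta$ is $\psi_\kappa(u)=u$ for $|u|\le\kappa$ and $\psi_\kappa(u)=\kappa\,\mathrm{sign}(u)$ for $|u|>\kappa$. Strictly skewed noise: let $Z$ be a real random variable with a continuous, strictly positive density on $\mathbb{R}$ and $\mathbb{E}|Z|<\infty$. For each $\kappa>0$ the equation $\mathbb{E}[\psi_\kappa(Z-b)]=0$ then has a unique root $b=b_\kappa\in\mathbb{R}$. $Z$ is called strictly skewed if there exists a sign $\sigma\in\{+1,-1\}$ such that for every $\kappa>0$, $\sigma\cdot\bigl(P(Z-b_\kappa>\kappa)-P(Z-b_\kappa<-\kappa)\bigr)>0$. *)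

(* Defs.v *)
From HB Require Import structures.
From mathcomp Require Import all_boot all_order all_algebra.
From mathcomp Require Import all_classical all_reals all_analysis.
Set Implicit Arguments.
Unset Strict Implicit.
Unset Printing Implicit Defensive.
Import Order.TTheory GRing.Theory Num.Theory.
Import numFieldNormedType.Exports.
Local Open Scope classical_set_scope.
Local Open Scope ring_scope.

Definition huber_loss (R : realType) (k theta a : R) : R :=
  if `|a - theta| <= k then 2^-1 * (a - theta) ^+ 2
  else k * `|a - theta| - 2^-1 * k ^+ 2.

(* The derivative of the Huber loss in the residual u = a - theta. *)
Definition huber_psi (R : realType) (k u : R) : R :=
  if `|u| <= k then u else k * Num.sg u.

Definition location_loss (R : realType) (ell : R -> R) (theta a : R) : R :=
  ell (a - theta).

Definition has_positive_continuous_density d (T : measurableType d)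
    (R : realType) (P : probability T R) (Z : {RV P >-> R}) : Prop :=
  exists f : R -> R,
    [/\ continuous f, (forall x, 0 < f x) &
      forall A : set R, measurable A ->
        distribution P Z A = (\int[lebesgue_measure]_(x in A) (f x)%:E)%E].

(* A root b of E[psi_k(Z - b)] = 0.  Such a root exists and is unique as soon
   as k > 0, Z has a positive continuous density and E|Z| is finite; otherwise
   the value is a choice made by get. *)
Definition huber_center d (T : measurableType d) (R : realType)
    (P : probability T R) (Z : {RV P >-> R}) (k : R) : R :=
  get [set b : R | ('E_P[fun w => huber_psi k (Z w - b)%R] = 0)%E].

Definition strictly_skewed d (T : measurableType d) (R : realType)
    (P : probability T R) (Z : {RV P >-> R}) : Prop :=
  [/\ has_positive_continuous_density Z,
      ('E_P[fun w => `|Z w|%R] < +oo)%E &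
      exists sigma : R, (sigma = 1 \/ sigma = -1) /\
        forall k : R, 0 < k ->
          (0 < sigma%:E *
            (P [set w | (Z w - huber_center Z k > k)%R] -
             P [set w | (Z w - huber_center Z k < - k)%R]))%E].

Definition shift_rule (R : realType) (b x : R) : R := x - b.

Definition equivariant_rules (R : realType) : set (R -> R) :=
  [set delta | exists b : R, delta = shift_rule b].

(* E_theta[L(theta, delta(X))] in the location model X = theta + Z. *)
Definition location_risk d (T : measurableType d) (R : realType)
    (P : probability T R) (Z : {RV P >-> R})
    (L : R -> R -> R) (theta : R) (delta : R -> R) : \bar R :=
  'E_P[fun w => L theta (delta (theta + Z w)%R)]%E.

(* Minimality is required at every theta; for a location loss the risk of an
   equivariant rule is constant in theta, so one value of theta would do. *)
Definition oracle d (T : measurableType d) (R : realType)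
    (P : probability T R) (Z : {RV P >-> R}) (L : R -> R -> R) :
    set (R -> R) :=
  [set delta | equivariant_rules delta /\
    forall (theta : R) (delta' : R -> R), equivariant_rules delta' ->
      (location_risk Z L theta delta <= location_risk Z L theta delta')%E].

Definition exclusively_realizable (R : realType) (D : set (R -> R))
    (O : (R -> R -> R) -> set (R -> R)) (L L' : R -> R -> R) : Prop :=
  ~ exists2 delta, D delta & O L delta /\ O L' delta.

(* Main.v *)
Require Import Defs.
From HB Require Import structures.
From mathcomp Require Import all_boot all_order all_algebra.
From mathcomp Require Import all_classical all_reals all_analysis.
From mathcomp Require Import measurable_realfun ring lra.
Import Order.TTheory GRing.Theory Num.Theory.
Import numFieldNormedType.Exports.
Local Open Scope classical_set_scope.
Local Open Scope ring_scope.

(* Tangent lines below and parabolas of curvature 1 above the Huber loss show,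
   without differentiating under the expectation, that b minimizes the risk iff
   g(k, b) = E[psi_k(Z - b)] vanishes.  For fixed b the derivative of g in k is
   P(Z - b > k) - P(Z - b < -k).  Where g(k, b) = 0 the point b is the center
   b_k, by strict monotonicity of g in b, so strict skewness gives that
   derivative a sign which is the same for all k.  Hence k |-> g(k, b) crosses
   zero always in the same direction, and by continuity it vanishes at most
   once. *)

(** * Pointwise inequalities for the Huber loss and its derivative *)

Lemma huber_psi_cases {R : realType} (k u : R) : 0 < k ->
  [\/ u < - k /\ huber_psi k u = - k,
      - k <= u <= k /\ huber_psi k u = u |
      k < u /\ huber_psi k u = k].
Proof.
move=> k0; rewrite /huber_psi ler_norml.
have [uk|uk] := ltP u (- k).
  by rewrite ltr0_sg ?mulrN1; [constructor 1 | lra].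
have [ku|ku] := leP u k; first by constructor 2.
by rewrite gtr0_sg ?mulr1; [constructor 3 | lra].
Qed.

(** The loss is the maximum over [|p| <= k] of [p * u - p ^ 2 / 2], attained at [p = huber_psi k u].
    In this form it is polynomial in [u] and [huber_psi k u], so [huber_psi_cases] reduces
    inequalities to arithmetic. *)
Lemma huber_lossE {R : realType} (k u : R) : 0 < k ->
  huber_loss k 0 u = huber_psi k u * u - 2^-1 * huber_psi k u ^+ 2.
Proof.
move=> k0; rewrite /huber_loss /huber_psi subr0; case: ifPn => [_|uk].
  by field.
have u0 : u != 0 by apply: contraNneq uk => ->; rewrite normr0 ltW.
by rewrite -[k * _ * u]mulrA -normrEsg exprMn sqr_sg u0 mulr1.
Qed.

Lemma huber_loss_location {R : realType} (k : R) :
  huber_loss k = location_loss (huber_loss k 0).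
Proof.
by apply/funext => t; apply/funext => a; rewrite /location_loss /huber_loss subr0.
Qed.

(** Convexity: the left side equals [p * v - p ^ 2 / 2] with [p = huber_psi k u], one of the lines
    whose maximum is the loss at [v]. *)
Lemma huber_loss_ge_tangent {R : realType} (k u v : R) : 0 < k ->
  huber_loss k 0 u + huber_psi k u * (v - u) <= huber_loss k 0 v.
Proof.
move=> k0; rewrite !huber_lossE//.
have := sqr_ge0 (v - u).
case: (@huber_psi_cases R k u k0) => -[hu ->];
  case: (@huber_psi_cases R k v k0) => -[hv ->].
all: by try case/andP: hu => hu hu'; try case/andP: hv => hv hv'; nra.
Qed.

(** The derivative [huber_psi k] has slope at most 1, so the loss exceeds its tangent by at most
    half a square. *)
Lemma huber_loss_le_quadratic {R : realType} (k u v : R) : 0 < k ->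
  huber_loss k 0 v <=
  huber_loss k 0 u + huber_psi k u * (v - u) + 2^-1 * (v - u) ^+ 2.
Proof.
move=> k0; rewrite !huber_lossE//.
have := sqr_ge0 (v - u).
case: (@huber_psi_cases R k u k0) => -[hu ->];
  case: (@huber_psi_cases R k v k0) => -[hv ->].
all: by try case/andP: hu => hu hu'; try case/andP: hv => hv hv'; nra.
Qed.

Lemma huber_loss_ge0 {R : realType} (k u : R) : 0 < k -> 0 <= huber_loss k 0 u.
Proof.
move=> k0; rewrite /huber_loss subr0; case: (leP `|u|) => uk; last nra.
by rewrite mulr_ge0 ?invr_ge0 ?sqr_ge0.
Qed.

Lemma huber_loss_le {R : realType} (k u : R) : 0 < k ->
  huber_loss k 0 u <= k * `|u|.
Proof.
move=> k0; rewrite /huber_loss subr0 -(real_normK (num_real u)).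
by have := normr_ge0 u; case: (leP `|u|) => uk u0; nra.
Qed.

Lemma huber_psi_le {R : realType} (k u : R) : 0 < k -> `|huber_psi k u| <= k.
Proof.
move=> k0; rewrite ler_norml.
by case: (@huber_psi_cases R k u k0) => -[hu ->]; lra.
Qed.

Lemma huber_psi_nondecreasing {R : realType} (k u v : R) : 0 < k -> u <= v ->
  huber_psi k u <= huber_psi k v.
Proof.
move=> k0 uv.
by case: (@huber_psi_cases R k u k0) => -[hu ->];
  case: (@huber_psi_cases R k v k0) => -[hv ->]; lra.
Qed.

(** From [u] in [[0, k]], a move left by [t] lowers [huber_psi] by exactly [t], or reaches the
    plateau [-k] and lowers it by [u + k >= k]. This is the quantitative source of strict
    monotonicity in the shift. *)
Lemma huber_psi_increment {R : realType} (k u t : R) : 0 < k -> 0 <= t ->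
  0 <= u <= k -> Num.min t k <= huber_psi k u - huber_psi k (u - t).
Proof.
move=> k0 t0 u0k.
by case: (leP t k) => ?; case: (@huber_psi_cases R k u k0) => -[hu ->];
  case: (@huber_psi_cases R k (u - t) k0) => -[hv ->]; lra.
Qed.

Lemma huber_psi_lipschitz {R : realType} (x y u : R) : 0 < x -> 0 < y ->
  `|huber_psi y u - huber_psi x u| <= `|y - x|.
Proof.
move=> x0 y0; have := ler_norm (y - x); have := ler_norm (x - y).
rewrite (distrC x y) ler_norml.
by case: (@huber_psi_cases R x u x0) => -[hu ->];
  case: (@huber_psi_cases R y u y0) => -[hv ->]; lra.
Qed.

(** First-order expansion in the threshold. The map is piecewise affine, so an error can occur only
    when [u] is within [|y - x|] of a kink [x] or [-x], and then it is at most [|y - x|]. *)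
Lemma huber_psi_derivative {R : realType} (x y u : R) : 0 < x -> 0 < y ->
  `|huber_psi y u - huber_psi x u - (y - x) * ((x < u)%R%:R - (u < - x)%R%:R)|
  <= `|y - x| * ((`|u - x| <= `|y - x|)%R%:R + (`|u + x| <= `|y - x|)%R%:R).
Proof.
move=> x0 y0.
have near_bound : `|huber_psi y u - huber_psi x u -
    (y - x) * ((x < u)%R%:R - (u < - x)%R%:R)| <= `|y - x|.
  have := ler_norm (y - x); have := ler_norm (x - y); rewrite (distrC x y).
  move: `|y - x| => m; rewrite ler_norml => hm1 hm2.
  have [xu|ux] := ltP x u; [rewrite (_ : u < - x = false); last lra|
    have [ux'|xu'] := ltP u (- x)]; rewrite ?mulr1n ?mulr0n.
  - case: (@huber_psi_cases R x u x0) => -[? ->]; [lra|lra|].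
    by case: (@huber_psi_cases R y u y0) => -[? ->]; apply/andP; split; lra.
  - case: (@huber_psi_cases R x u x0) => -[? ->]; [|lra|lra].
    by case: (@huber_psi_cases R y u y0) => -[? ->]; apply/andP; split; lra.
  - case: (@huber_psi_cases R x u x0) => -[? ->]; [lra| |lra].
    by case: (@huber_psi_cases R y u y0) => -[? ->]; apply/andP; split; lra.
have [_|far] := leP `|u - x|.
  apply: le_trans near_bound _.
  by rewrite ler_peMr// mulr1n lerDl.
have [_|far'] := leP `|u + x|.
  apply: le_trans near_bound _.
  by rewrite ler_peMr// mulr1n lerDr.
(* Far from both kinks, [u] lies in the same region for the thresholds [x] and [y], so the expansion
   is exact. *)
rewrite mulr0n addr0 mulr0 normr_le0 subr_eq0; apply/eqP.
move: far far'; rewrite !lter_normr => far far'.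
have := ler_norm (y - x); have := ler_norm (x - y).
move: far far'; rewrite (distrC x y); move: `|y - x| => m far far' hm1 hm2.
have [xu|ux] := ltP x u.
  have yu : y < u by case/orP: far => ?; lra.
  rewrite (_ : u < - x = false); last by apply/negbTE; rewrite -leNgt; lra.
  rewrite mulr1n mulr0n.
  case: (@huber_psi_cases R x u x0) => -[? ->]; [lra|lra|].
  by case: (@huber_psi_cases R y u y0) => -[? ->]; lra.
have {}far : m < x - u by case/orP: far => ?; lra.
have [ux'|xu'] := ltP u (- x); rewrite ?mulr1n ?mulr0n.
  have yu : u < - y by case/orP: far' => ?; lra.
  case: (@huber_psi_cases R x u x0) => -[? ->]; [|lra|lra].
  by case: (@huber_psi_cases R y u y0) => -[? ->]; lra.
have {}far' : m < u + x by case/orP: far' => ?; lra.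
case: (@huber_psi_cases R x u x0) => -[? ->]; [lra| |lra].
by case: (@huber_psi_cases R y u y0) => -[? ->]; lra.
Qed.

(** * A real function that crosses zero only upwards *)

Lemma upcrossing_zero_unique (R : realType) (h : R -> R) (x y : R) :
  (forall t u, x <= t -> x <= u -> `|h u - h t| <= `|u - t|) ->
  (forall t, x <= t -> h t = 0 -> exists2 e, 0 < e &
     forall u, x <= u -> 0 < `|u - t| < e -> 0 < (u - t) * h u) ->
  x < y -> h x = 0 -> h y = 0 -> False.
Proof.
move=> lip cross xy hx hy.
(* The first point after x where h is nonpositive is a zero, and h is positive
   just before it: this contradicts the upward crossing there. *)
pose A := [set t | x < t <= y /\ h t <= 0].
have Ay : A y by split; [rewrite xy lexx | rewrite hy].
have [e e0 crossx] := cross x (lexx _) hx.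
(* The upward crossing at [x] keeps [h] positive just after [x], so [inf A] is strictly beyond
   [x]. *)
have lbA t : A t -> x + e <= t.
  move=> [/andP[xt _] ht]; rewrite leNgt; apply/negP => te.
  have te' : 0 < `|t - x| < e by rewrite gtr0_norm; lra.
  by have := crossx t (ltW xt) te'; rewrite pmulr_rgt0 ?subr_gt0//; lra.
have infA : has_inf A by split; [exists y | exists (x + e)].
have xc : x + e <= inf A by exact: lb_le_inf infA.1 lbA.
have cy : inf A <= y by apply: ge_inf => //; exact: infA.2.
have below t : x < t < inf A -> 0 < h t.
  move=> /andP[xt tc]; rewrite ltNge; apply/negP => ht.
  have : inf A <= t by apply: ge_inf; [exact: infA.2|split=> //; lra].
  by lra.
(* Otherwise some [t] in [A] is closer to [inf A] than [h (inf A)], and the Lipschitz bound forces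
   [h t > 0]. *)
have hc0 : h (inf A) <= 0.
  rewrite leNgt; apply/negP => hc.
  have [t At tc] := inf_adherent hc infA.
  have ct : inf A <= t by apply: ge_inf => //; exact: infA.2.
  have : `|h t - h (inf A)| <= `|t - inf A| by apply: lip; lra.
  by rewrite ler_norml ger0_norm ?subr_ge0//; case: At => _; lra.
have [hc1|hc1] := ltP (h (inf A)) 0.
  (* A point at distance at most [|h (inf A)|] to the left of [inf A], where the Lipschitz bound
     still gives [h t <= 0]; the midpoint keeps [t > x]. *)
  pose t := Num.max ((x + inf A) / 2) (inf A + h (inf A)).
  have tI : x < t < inf A by rewrite /t; case: (leP ((x + inf A) / 2)) => ?; lra.
  have := below t tI.
  have : `|h t - h (inf A)| <= `|t - inf A| by apply: lip; lra.
  rewrite ler_norml ler0_norm ?subr_le0; last lra.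
  by move: tI; rewrite /t; case: (leP ((x + inf A) / 2)) => ?; lra.
have hc : h (inf A) = 0 by apply/eqP; rewrite eq_le hc0 hc1.
have [d d0 crossc] := cross (inf A) (ltac:(lra)) hc.
pose t := Num.max ((x + inf A) / 2) (inf A - d / 2).
have tI : x < t < inf A by rewrite /t; case: (leP ((x + inf A) / 2)) => ?; lra.
have td : 0 < `|t - inf A| < d.
  by rewrite ltr0_norm; move: tI; rewrite /t; case: (leP ((x + inf A) / 2)) => ?; lra.
have := below t tI; have := crossc t _ td.
by rewrite nmulr_rgt0; [lra | lra].
Qed.

Section noise.
Context {d} {T : measurableType d} {R : realType} {P : probability T R}.
Implicit Type Z : {RV P >-> R}.

(** * Probabilities of small sets and of intervals *)

(** Absolute continuity of the integral of the density, which is integrable because its total mass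
    is 1. *)
Lemma small_measure_small_probability Z : has_positive_continuous_density Z ->
  forall e : R, 0 < e -> exists2 r : R, 0 < r &
    forall A : set R, measurable A -> (lebesgue_measure A < r%:E)%E ->
      (P (Z @^-1` A) < e%:E)%E.
Proof.
move=> [f [cf f0 Pf]] e e0.
have mf : measurable_fun setT f by exact: continuous_measurable_fun.
have intf : lebesgue_measure.-integrable setT (EFin \o f).
  apply/integrableP; split; first exact/measurable_EFinP.
  under eq_integral do rewrite /= ger0_norm ?(ltW (f0 _))//.
  by rewrite -Pf// probability_setT ltry.
have [r [r0 fr]] := integral_normr_continuous intf e0.
exists r => // A mA Ar; have := fr A mA Ar.
rewrite /Rintegral.
under eq_integral do rewrite /= ger0_norm ?(ltW (f0 _))//.
by rewrite -Pf// -lte_fin fineK// fin_num_measure.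
Qed.

(** If the probability were zero, the density would vanish almost everywhere on [[x, y]]; being
    positive, it would force [[x, y]] into a Lebesgue null set. *)
Lemma interval_probability_gt0 Z : has_positive_continuous_density Z ->
  forall x y : R, x < y -> (0 < P [set w | x <= Z w <= y]%R)%E.
Proof.
move=> [f [cf f0 Pf]] x y xy.
have -> : [set w | x <= Z w <= y] = Z @^-1` `[x, y].
  by apply/seteqP; split => w /=; rewrite in_itv.
rewrite lt_neqAle measure_ge0 andbT eq_sym; apply/eqP => P0.
have mf : measurable_fun `[x, y] (EFin \o f).
  by apply/measurable_EFinP/measurable_funTS; exact: continuous_measurable_fun.
have : (\int[lebesgue_measure]_(t in `[x, y]) `|(f t)%:E| = 0)%E.
  under eq_integral do rewrite /= ger0_norm ?(ltW (f0 _))//.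
  by rewrite -Pf.
have /[apply] := (ae_eq_integral_abs lebesgue_measure (measurable_itv _) mf).1.
move=> [N [mN N0 sub]].
have : (lebesgue_measure `[x, y] <= lebesgue_measure N)%E.
  apply: le_measure; rewrite ?inE// => t xyt; apply: sub => /= /(_ xyt) [ft].
  by have := f0 t; rewrite ft ltxx.
by rewrite N0 lebesgue_measure_itv/= lte_fin xy -EFinB lee_fin; lra.
Qed.

Lemma small_ball_probability Z : has_positive_continuous_density Z ->
  forall e : R, 0 < e -> exists2 r : R, 0 < r &
    forall x s : R, s <= r -> fine (P [set w | `|Z w - x| <= s]) < e.
Proof.
move=> dZ e e0; have [r r0 Pr] := small_measure_small_probability Z dZ e e0.
(* A ball of radius at most [r / 3] has length at most [2 * r / 3 < r], whatever its center; hence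
   the uniformity in [x]. *)
exists (r / 3) => [|x s sr]; first lra.
have -> : [set w | `|Z w - x| <= s] = Z @^-1` `[x - s, x + s].
  by apply/seteqP; split => w /=; rewrite in_itv/= ler_distl.
have mZ : measurable (Z @^-1` `[x - s, x + s]) by exact: measurable_funPTI.
rewrite -lte_fin fineK ?fin_num_measure//; apply: Pr => //.
rewrite lebesgue_measure_itv/=; case: ifP => _; last by rewrite lte_fin.
by rewrite -EFinB lte_fin; lra.
Qed.

(** * Measurability and integrability *)

Lemma measurable_centered Z (b : R) (p : R -> bool) :
  measurable [set u | p u] -> measurable [set w | p (Z w - b)].
Proof.
move=> mp; have mZ : measurable_fun setT (fun w => Z w - b).
  by apply: measurable_funB => //; exact: measurable_cst.
by rewrite -[X in measurable X]setTI; exact: (mZ measurableT _ mp).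
Qed.

Lemma measurable_upper_tail Z (b x : R) : measurable [set w | x < Z w - b].
Proof.
apply: measurable_centered; rewrite (_ : [set u | _] = `]x, +oo[%classic)//.
by apply/seteqP; split => u /=; rewrite in_itv/= andbT.
Qed.

Lemma measurable_lower_tail Z (b x : R) : measurable [set w | Z w - b < x].
Proof.
apply: (measurable_centered Z b (fun u => u < x)).
by rewrite (_ : [set u | _] = `]-oo, x[%classic).
Qed.

Let mem_set_bool (p : T -> bool) w : (w \in [set v | p v]) = p w.
Proof. by apply/idP/idP; rewrite inE. Qed.

(** Indicators are kept as coerced booleans, the form in which [huber_psi_derivative] produces
    them. *)
Lemma integrable_bool (p : T -> bool) : measurable [set w | p w] ->
  P.-integrable setT (EFin \o (fun w => (p w)%:R : R)).
Proof.
move=> mp; have := integrable_indic P mp.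
by apply: eq_integrable => // w _; rewrite /= indicE mem_set_bool.
Qed.

Lemma Rintegral_bool (p : T -> bool) : measurable [set w | p w] ->
  (\int[P]_w (p w)%:R)%R = fine (P [set w | p w]) :> R.
Proof.
move=> mp; rewrite /Rintegral -[X in P X]setIT -integral_indic//.
by congr fine; apply: eq_integral => w _; rewrite /= indicE mem_set_bool.
Qed.

Lemma expectation_Rintegral (X : T -> R) :
  P.-integrable setT (EFin \o X) -> 'E_P[X]%E = (\int[P]_w X w)%:E.
Proof. by move=> iX; rewrite unlock fineK// integrable_fin_num. Qed.

Lemma integrable_huber_psi Z (k b : R) : 0 < k ->
  P.-integrable setT (EFin \o (fun w => huber_psi k (Z w - b))).
Proof.
move=> k0; apply: (@le_integrable _ _ _ P setT measurableT _ (EFin \o cst k)).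
- apply/measurable_EFinP.
  apply: (@measurableT_comp _ _ _ _ _ _ (huber_psi k)).
    apply: nondecreasing_measurable => // u v.
    exact: huber_psi_nondecreasing.
  by apply: measurable_funB => //; exact: measurable_cst.
- move=> w _; rewrite /= lee_fin (@gtr0_norm _ k)//; exact: huber_psi_le.
- exact: finite_measure_integrable_cst.
Qed.

Lemma integrable_huber_loss Z (k b : R) : 0 < k ->
  ('E_P[fun w => `|Z w|%R] < +oo)%E ->
  P.-integrable setT (EFin \o (fun w => huber_loss k 0 (Z w - b))).
Proof.
move=> k0 EZ; have iZ : P.-integrable setT (EFin \o Z).
  apply/integrableP; split; first exact/measurable_EFinP.
  by move: EZ; rewrite unlock.
apply: (@le_integrable _ _ _ P setT measurableT _
  (EFin \o (fun w => k * (`|Z w| + `|b|)))).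
- apply/measurable_EFinP.
  (* Measurability of the loss is inherited from [huber_psi], which is measurable because it is
     monotone. *)
  rewrite (_ : (fun _ => _) = (fun w => huber_psi k (Z w - b) * (Z w - b) -
    2^-1 * huber_psi k (Z w - b) ^+ 2)); last first.
    by apply/funext => w; rewrite huber_lossE.
  have mp := measurable_int _ (integrable_huber_psi Z k b k0).
  move/measurable_EFinP : mp => mp.
  apply: measurable_funB; last exact/measurable_funM/measurable_funX.
  apply: measurable_funM => //.
  by apply: measurable_funB => //; exact: measurable_cst.
- move=> w _; rewrite /= lee_fin ger0_norm ?huber_loss_ge0// ger0_norm; last first.
    by rewrite mulr_ge0 ?addr_ge0// ltW.
  apply: le_trans (huber_loss_le _ _ k0) _.
  by rewrite ler_pM2l// (le_trans (ler_normB _ _)).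
- apply: (@eq_integrable _ _ _ P setT measurableT
    (fun w => k%:E * (`|(Z w)%:E| + `|b|%:E))%E) => [w _|].
    by rewrite /= -EFinD -EFinM.
  apply: integrableZl => //; apply: integrableD => //.
    exact: integrable_abse iZ.
  exact: finite_measure_integrable_cst.
Qed.

Lemma Rintegral_probability_cst (r : R) : \int[P]_(_ in setT) r = r.
Proof.
rewrite Rintegral_cst// -[X in _ * fine X]/((P : set T -> \bar R) setT).
by rewrite (probability_setT P) mulr1.
Qed.

(** * The mean of [huber_psi] as a function of threshold and shift *)

Definition huber_mean Z (k b : R) : R := \int[P]_w huber_psi k (Z w - b).

Lemma expectation_huber_psi Z (k b : R) : 0 < k ->
  'E_P[fun w => huber_psi k (Z w - b)]%E = (huber_mean Z k b)%:E.
Proof.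
by move=> k0; rewrite expectation_Rintegral//; exact: integrable_huber_psi.
Qed.

(** The integrand never increases with the shift, and on the event [0 <= Z - b <= k], of positive
    probability, it drops by at least [min (b' - b) k]. *)
Lemma huber_mean_decreasing Z (k b b' : R) : has_positive_continuous_density Z ->
  0 < k -> b < b' -> huber_mean Z k b' < huber_mean Z k b.
Proof.
move=> dZ k0 bb'; rewrite -subr_gt0 /huber_mean -RintegralB//;
  [|exact: integrable_huber_psi..].
pose p u := (0 <= u <= k) : bool.
have mp : measurable [set w | p (Z w - b)].
  by apply: measurable_centered; rewrite (_ : [set u | p u] = `[0, k]%classic).
pose c := Num.min (b' - b) k.
have c0 : 0 < c by rewrite lt_min k0 subr_gt0 bb'.
apply: (@lt_le_trans _ _ (\int[P]_w (c * (p (Z w - b))%:R))).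
  rewrite RintegralZl//; last exact: integrable_bool.
  rewrite Rintegral_bool// mulr_gt0// fine_gt0// -ge0_fin_numE//.
  rewrite fin_num_measure// andbT.
  rewrite (_ : [set w | p (Z w - b)] = [set w | b <= Z w <= b + k]); last first.
    by apply/seteqP; split => w /=; rewrite /p subr_ge0 lerBlDl.
  by apply: interval_probability_gt0 => //; lra.
apply: le_Rintegral => //.
- by have := integrableZl measurableT c (integrable_bool _ mp).
- by have := integrableB measurableT (integrable_huber_psi Z k b k0)
    (integrable_huber_psi Z k b' k0).
- move=> w _; have -> : Z w - b' = Z w - b - (b' - b) by ring.
  case pw : (p (Z w - b)); rewrite ?mulr1 ?mulr0.
    by apply: huber_psi_increment => //; rewrite subr_ge0 ltW.
  by rewrite subr_ge0 huber_psi_nondecreasing// gerBl subr_ge0 ltW.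
Qed.

(** Since [b] is a root, [get] does return a root, and strict monotonicity leaves no other. Thus the
    skewness hypothesis applies at every zero of [huber_mean]. *)
Lemma huber_center_root Z (k b : R) : has_positive_continuous_density Z ->
  0 < k -> huber_mean Z k b = 0 -> huber_center Z k = b.
Proof.
move=> dZ k0 b0.
have : [set c | ('E_P[fun w => huber_psi k (Z w - c)%R] = 0)%E] (huber_center Z k).
  by apply: (@getI _ _ b) => /=; rewrite expectation_huber_psi// b0.
rewrite /= expectation_huber_psi// => -[c0].
have [|h|//] := ltgtP (huber_center Z k) b => [h|].
  by have := huber_mean_decreasing Z k _ _ dZ k0 h; rewrite c0 b0 ltxx.
by have := huber_mean_decreasing Z k _ _ dZ k0 h; rewrite c0 b0 ltxx.
Qed.

Lemma huber_mean_lipschitz Z (b x y : R) : 0 < x -> 0 < y ->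
  `|huber_mean Z y b - huber_mean Z x b| <= `|y - x|.
Proof.
move=> x0 y0; rewrite /huber_mean -RintegralB//; [|exact: integrable_huber_psi..].
have iB := integrableB measurableT (integrable_huber_psi Z y b y0)
  (integrable_huber_psi Z x b x0).
apply: le_trans (le_normr_Rintegral _ _) _ => //.
apply: (@le_trans _ _ (\int[P]_(w in setT) `|y - x|)).
  apply: le_Rintegral => //.
  - exact: integrable_norm.
  - exact: finite_measure_integrable_cst.
  - by move=> w _; exact: huber_psi_lipschitz.
by rewrite Rintegral_probability_cst.
Qed.

(** Integrated form of [huber_psi_derivative]: the error is [|y - x|] times the probabilities that
    [Z] is near the kinks [b + x] and [b - x], hence of smaller order by
    [small_ball_probability]. *)
Lemma huber_mean_derivative Z (b x y : R) : 0 < x -> 0 < y ->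
  `|huber_mean Z y b - huber_mean Z x b -
    (y - x) * (fine (P [set w | x < Z w - b]) - fine (P [set w | Z w - b < - x]))|
  <= `|y - x| * (fine (P [set w | `|Z w - (b + x)| <= `|y - x|]) +
                 fine (P [set w | `|Z w - (b - x)| <= `|y - x|])).
Proof.
move=> x0 y0.
have m1 : measurable [set w | x < Z w - b] by exact: measurable_upper_tail.
have m2 : measurable [set w | Z w - b < - x] by exact: measurable_lower_tail.
have m3 c r : measurable [set w | `|Z w - c| <= r].
  apply: (measurable_centered Z c (fun u => `|u| <= r)).
  rewrite (_ : [set u | _] = `[- r, r]%classic)//.
  by apply/seteqP; split => u /=; rewrite in_itv/= ler_norml.
have i1 := integrable_bool _ m1; have i2 := integrable_bool _ m2.
have i3 c r := integrable_bool _ (m3 c r).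
have iy := integrable_huber_psi Z y b y0.
have ix := integrable_huber_psi Z x b x0.
have i12 := integrableB measurableT i1 i2.
have i12' := integrableZl measurableT (y - x) i12.
have ixy := integrableB measurableT iy ix.
have i33 c c' r := integrableD measurableT (i3 c r) (i3 c' r).
rewrite -!Rintegral_bool// /huber_mean -RintegralD// -RintegralZl//; last exact: i33.
rewrite -(RintegralB measurableT iy ix) -(RintegralB measurableT i1 i2).
rewrite -(RintegralZl _ measurableT i12) -(RintegralB measurableT ixy i12').
apply: le_trans (le_normr_Rintegral _ _) _ => //.
  exact: (integrableB measurableT ixy i12').
apply: le_Rintegral => //.
- by apply: integrable_norm; exact: (integrableB measurableT ixy i12').
- exact: (integrableZl measurableT `|y - x| (i33 (b + x) (b - x) `|y - x|)).
- move=> w _.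
  have := huber_psi_derivative x y (Z w - b) x0 y0.
  have -> : Z w - (b + x) = Z w - b - x by ring.
  by have -> : Z w - (b - x) = Z w - b + x by ring.
Qed.

Lemma huber_mean_threshold_unique Z (b k k' : R) : strictly_skewed Z ->
  0 < k -> k < k' -> huber_mean Z k b = 0 -> huber_mean Z k' b = 0 -> False.
Proof.
move=> [dZ _ [s [s1 skew]]] k0 kk' gk gk'.
have ns : `|s| = 1 by case: s1 => ->; rewrite ?normrN1 ?normr1.
(* The factor [s] turns crossings in the direction prescribed by the skewness into upward ones. *)
apply: (@upcrossing_zero_unique R (fun t => s * huber_mean Z t b) k k') => //;
  rewrite ?gk ?gk' ?mulr0//.
- move=> t u kt ku; rewrite -mulrBr normrM ns mul1r.
  by apply: huber_mean_lipschitz; lra.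
move=> t kt gt0.
have t0 : 0 < t by lra.
have {}gt0 : huber_mean Z t b = 0.
  by apply/eqP; move/eqP: gt0; rewrite mulf_eq0 -normr_eq0 ns oner_eq0.
have := skew t t0; rewrite (huber_center_root Z t b)//.
set p1 := P _; set p2 := P _.
have m1 : measurable [set w | t < Z w - b] by exact: measurable_upper_tail.
have m2 : measurable [set w | Z w - b < - t] by exact: measurable_lower_tail.
rewrite -(@fineK _ p1) ?fin_num_measure// -(@fineK _ p2) ?fin_num_measure//.
rewrite -EFinB -EFinM lte_fin => D0.
(* Half of the signed derivative for each of the two kinks, so that the total error stays below that
   derivative. *)
have [r r0 small] := small_ball_probability Z dZ _ (divr_gt0 D0 (ltr0n R 2)).
exists r => // u ku /andP[ut0 utr].
have u0 : 0 < u by lra.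
have B1 := small (b + t) `|u - t| (ltW utr).
have B2 := small (b - t) `|u - t| (ltW utr).
have := huber_mean_derivative Z b t u t0 u0; rewrite gt0 subr0 -/p1 -/p2.
move: B1 B2 D0; move: (fine p1 - fine p2) => D.
move: (fine _) => q1; move: (fine _) => q2 B1 B2 D0 H.
(* Multiplying by [|u - t|] makes the main term of [(u - t) * (s * huber_mean Z u b)] equal to
   [(u - t) ^ 2 * (s * D)], which beats the error [(u - t) ^ 2 * (q1 + q2)]. *)
have {}H : `|u - t| * `|huber_mean Z u b - (u - t) * D| <=
    `|u - t| ^+ 2 * (q1 + q2) by rewrite expr2 -mulrA ler_pM2l.
have : `|(u - t) * (s * (huber_mean Z u b - (u - t) * D))| <=
    `|u - t| ^+ 2 * (q1 + q2) by rewrite !normrM ns mul1r.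
rewrite ler_norml => /andP[H' _].
have : `|u - t| ^+ 2 * (q1 + q2) < `|u - t| ^+ 2 * (s * D).
  by rewrite ltr_pM2l ?exprn_gt0//; lra.
rewrite real_normK ?num_real// in H' *.
by move=> H''; nra.
Qed.

(** * Oracle risk minimization and first-order conditions *)

Lemma location_risk_shift_rule Z (ell : R -> R) (theta b : R) :
  location_risk Z (location_loss ell) theta (shift_rule b) =
  'E_P[fun w => ell (Z w - b)%R]%E.
Proof.
rewrite /location_risk /location_loss /shift_rule; congr ('E_P[_])%E.
by apply/funext => w; congr ell; ring.
Qed.

Lemma oracle_shift_rule Z (ell : R -> R) (b : R) :
  oracle Z (location_loss ell) (shift_rule b) <->
  forall b' : R,
    ('E_P[fun w => ell (Z w - b)%R] <= 'E_P[fun w => ell (Z w - b')%R])%E.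
Proof.
split=> [[_ min] b'|min].
  by have := min 0 _ (ex_intro _ b' erefl); rewrite !location_risk_shift_rule.
split=> [|theta _ [b' ->]]; first by exists b.
by rewrite !location_risk_shift_rule.
Qed.

Lemma oracle_huber Z (k b : R) : 0 < k -> ('E_P[fun w => `|Z w|%R] < +oo)%E ->
  oracle Z (huber_loss k) (shift_rule b) <-> huber_mean Z k b = 0.
Proof.
move=> k0 EZ; rewrite huber_loss_location oracle_shift_rule.
have iL c := integrable_huber_loss Z k c k0 EZ.
have iP := integrable_huber_psi Z k b k0.
have iPt t := integrableZl measurableT t iP.
split=> [min|g0 b'].
  (* Moving b by m = E[psi_k(Z - b)] lowers the risk by at least m^2 / 2. *)
  set m := huber_mean Z k b.
  have ic := finite_measure_integrable_cst P (2^-1 * m ^+ 2) measurableT.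
  have iq := integrableD measurableT (iPt (- m)) ic.
  have := min (b + m); rewrite !expectation_Rintegral// lee_fin => minm.
  have : \int[P]_w huber_loss k 0 (Z w - (b + m)) <=
    \int[P]_w (huber_loss k 0 (Z w - b) +
       ((- m) * huber_psi k (Z w - b) + 2^-1 * m ^+ 2)).
    apply: le_Rintegral => //.
    - exact: (integrableD measurableT (iL b) iq).
    - move=> w _; have := huber_loss_le_quadratic k (Z w - b) (Z w - (b + m)) k0.
      have -> : Z w - (b + m) - (Z w - b) = - m by ring.
      by rewrite sqrrN mulrC addrA.
  rewrite RintegralD// RintegralD//; last exact: iPt.
  rewrite RintegralZl// Rintegral_probability_cst -/(huber_mean Z k b) -/m /=.
  move=> H; have : m ^+ 2 <= 0 by nra.
  by rewrite -/m real_exprn_even_le0 ?num_real// => /eqP.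
rewrite !expectation_Rintegral// lee_fin.
(* Integrating the tangent inequality: the linear term vanishes because the mean is zero at [b],
   leaving the risk at [b] as a lower bound. *)
have : \int[P]_w (huber_loss k 0 (Z w - b) + (b - b') * huber_psi k (Z w - b))
    <= \int[P]_w huber_loss k 0 (Z w - b').
  apply: le_Rintegral => //.
  - exact: (integrableD measurableT (iL b) (iPt _)).
  - move=> w _; have := huber_loss_ge_tangent k (Z w - b) (Z w - b') k0.
    by rewrite (_ : Z w - b' - (Z w - b) = b - b') 1?mulrC//; ring.
rewrite RintegralD//; last exact: iPt.
by rewrite RintegralZl// -/(huber_mean Z k b) g0 mulr0 addr0.
Qed.

End noise.

Theorem theorem3 (d : measure_display) (T : measurableType d) (R : realType)
    (P : probability T R) (Z : {RV P >-> R}) (hZ : strictly_skewed Z) :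
  [/\ (forall (ell : R -> R) (theta b : R),
         location_risk Z (location_loss ell) theta (shift_rule b) =
         'E_P[fun w => ell (Z w - b)%R]%E),
      (forall (ell : R -> R) (b : R),
         oracle Z (location_loss ell) (shift_rule b) <->
         forall b' : R,
           ('E_P[fun w => ell (Z w - b)%R] <= 'E_P[fun w => ell (Z w - b')%R])%E),
      (forall k b : R, 0 < k ->
         oracle Z (huber_loss k) (shift_rule b) <->
         'E_P[fun w => huber_psi k (Z w - b)%R]%E = 0%E) &
      (forall k k' : R, 0 < k -> 0 < k' -> k != k' ->
         exclusively_realizable (@equivariant_rules R) (oracle Z)
           (huber_loss k) (huber_loss k'))].
Proof.
have [_ EZ _] := hZ.
split.
- exact: location_risk_shift_rule.
- exact: oracle_shift_rule.
- move=> k b k0; rewrite oracle_huber// expectation_huber_psi//.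
  by split=> [->//|[]].
- move=> k k' k0 k'0 kk' [_ [b ->]] [].
  (* A rule optimal for both losses gives one shift [b] at which the means for both thresholds
     vanish. *)
  move=> /(oracle_huber Z k b k0 EZ) gk /(oracle_huber Z k' b k'0 EZ) gk'.
  case/lt_total/orP: kk' => h.
    exact: (huber_mean_threshold_unique Z b k k').
  exact: (huber_mean_threshold_unique Z b k' k).
Qed.
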